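(* Assume the following. (i) The step size is constant, $\eta_j=c_0>0$ for all $j\ge 0$, with $c_0\le\big(\max(\max_i\|a_i\|^2,\|B\|^2)\big)^{-1}$. (ii) There exist $\nu>0$ and $w\in\mathbb{R}^m$ such that $x^\dagger-x_0=B^\nu w$. (iii) $A=\Sigma V^t$ with $\Sigma\in\mathbb{R}^{n\times m}$ diagonal with nonnegative entries and $V\in\mathbb{R}^{m\times m}$ with orthonormal columns. Let $$c_B=(1-c_0\|B\|)^{-M},\qquad c_{B,M}=\sum_{i=1}^{M-1}\big(1-(1-c_0\|B\|)^i\big)^2,$$ and let $c_*>1$ satisfy $$\big(4+2(Mc_0\|B\|)^2\big)\,nM^{-2}c_Bc_{B,M}\le 1-c_*^{-1}.$$ Set $c_\nu=\nu^\nu(Mc_0)^{-\nu}$ and $c_{**}=\big(3+2(Mc_0\|B\|)^2\big)nMc_Bc_0^2\|B\|$. Then for every integer $K\ge 1$ the SVRG iterates satisfy $$\mathbb{E}\big[\|x_{KM}^\delta-x^\dagger\|^2\big]\le\big(2+2^{2\nu}\|B\|c_{**}c_*\big)c_\nu^2K^{-2\nu}\|w\|^2+\big(2Mc_0+c_{**}c_*\big)K\bar\delta^2 .$$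
   Context: Let $n,m,M\ge 1$ be integers, $A\in\mathbb{R}^{n\times m}$ with $i$-th row $a_i^t$ ($a_i\in\mathbb{R}^m$), $x_0\in\mathbb{R}^m$ an initial guess, $y^\dagger\in\mathbb{R}^n$ in the range of $A$, and $x^\dagger=\arg\min\{\|x-x_0\|: x\in\mathbb{R}^m,\ Ax=y^\dagger\}$. The data are $y^\delta=y^\dagger+\xi$ with a fixed (deterministic) noise vector $\xi\in\mathbb{R}^n$; $\delta=\|\xi\|$ and $\bar\delta=n^{-1/2}\delta$. $\|\cdot\|$ is the Euclidean norm for vectors and the spectral norm for matrices. Let $B=n^{-1}A^tA$; it is assumed throughout that $\|B\|\le 1$. It is implicit that $c_0\|B\|<1$ so that $c_B$ is finite. SVRG with constant step size $c_0$ and frequency $M$: let $i_0,i_1,\dots$ be i.i.d. uniform on $\{1,\dots,n\}$, $J(x)=\frac1{2n}\|Ax-y^\delta\|^2$, so $J'(x)=n^{-1}A^t(Ax-y^\delta)$, and $k_M=\lfloor k/M\rfloor M$. Set $x_0^\delta=x_0$ and, for $k\ge 0$, $$x_{k+1}^\delta=x_k^\delta-c_0\big((a_{i_k},x_k^\delta-x_{k_M}^\delta)\,a_{i_k}+J'(x_{k_M}^\delta)\big).$$ $\mathbb{E}$ is expectation over the random indices. *)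

(* Defs.v *)
From HB Require Import structures.
From mathcomp Require Import all_boot all_order all_algebra.
From mathcomp Require Import all_classical all_reals all_analysis.

Set Implicit Arguments.
Unset Strict Implicit.
Unset Printing Implicit Defensive.

Import Order.TTheory GRing.Theory Num.Theory.

Local Open Scope classical_set_scope.
Local Open Scope ring_scope.

Section Euclidean.
Context {R : realType}.

Definition dotp m (u v : 'cV[R]_m) : R := \sum_i u i 0 * v i 0.

(* The library norm `|u| on matrices is the sup norm, hence this definition. *)
Definition l2norm m (u : 'cV[R]_m) : R := Num.sqrt (dotp u u).

(* Spectral norm, i.e. the operator norm induced by l2norm. *)
Definition opnorm n m (A : 'M[R]_(n, m)) : R :=
  sup [set l2norm (A *m x) | x in [set x : 'cV[R]_m | l2norm x <= 1]].

(* C = B ^ s by functional calculus, for B symmetric positive semidefinite. *)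
Definition is_psd_powR m (B : 'M[R]_m) (s : R) (C : 'M[R]_m) : Prop :=
  exists (U : 'M[R]_m) (d : 'rV[R]_m),
    [/\ U^T *m U = 1%:M,
        forall i, 0 <= d 0 i,
        B = U *m diag_mx d *m U^T
      & C = U *m diag_mx (map_mx (fun x => x `^ s) d) *m U^T].

(* The choice of C is immaterial by is_psd_powR_unique; the default 0 is only
   reached when B is not symmetric positive semidefinite. *)
Definition psd_powR m (B : 'M[R]_m) (s : R) : 'M[R]_m :=
  xget 0 [set C | is_psd_powR B s C].

Lemma is_psd_powR_unique m (B : 'M[R]_m) s C C' :
  is_psd_powR B s C -> is_psd_powR B s C' -> C = C'.
Proof.
move=> [U [d [UU _ -> ->]]] [V [e [VV _ eB ->]]].
have UU' : U *m U^T = 1%:M by exact: mulmx1C.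
have VV' : V *m V^T = 1%:M by exact: mulmx1C.
have key : V^T *m U *m diag_mx d = diag_mx e *m (V^T *m U).
  have := congr1 (fun X => V^T *m X *m U) eB.
  by rewrite !mulmxA VV mul1mx -!mulmxA UU mulmx1.
have keys : V^T *m U *m diag_mx (map_mx (fun x => x `^ s) d) =
    diag_mx (map_mx (fun x => x `^ s) e) *m (V^T *m U).
  move: (V^T *m U) key => W key.
  apply/matrixP => i j; move/matrixP/(_ i j): key.
  rewrite !mul_mx_diag !mul_diag_mx !mxE => h.
  have [->|w0] := eqVneq (W i j) 0; first by rewrite mul0r mulr0.
  have -> : e 0 i = d 0 j by apply: (mulIf w0); rewrite -h mulrC.
  by rewrite mulrC.
have := congr1 (fun X => V *m X *m U^T) keys.
by rewrite !mulmxA VV' mul1mx -!mulmxA UU' mulmx1.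
Qed.

Lemma psd_powRE m (B : 'M[R]_m) s C : is_psd_powR B s C -> psd_powR B s = C.
Proof.
move=> BC; apply: (@is_psd_powR_unique _ B s) => //.
exact: (@xgetPex _ 0 [set C | is_psd_powR B s C]) (ex_intro _ C BC).
Qed.

(* x is the solution of A x = y closest to x0; it is unique when it exists. *)
Definition is_closest_solution n m (A : 'M[R]_(n, m)) (y : 'cV[R]_n)
    (x0 x : 'cV[R]_m) : Prop :=
  A *m x = y /\
  forall z : 'cV[R]_m, A *m z = y -> l2norm (x - x0) <= l2norm (z - x0).

End Euclidean.

(* The indices {1, ..., n} are represented by 'I_n = {0, ..., n-1}. *)
Definition iid_uniform {R : realType} {d : measure_display}
    {T : measurableType d} (P : probability T R) n (I : nat -> T -> 'I_n) : Prop :=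
  [/\ forall k i, measurable (I k @^-1` [set i]),
      forall k i, P (I k @^-1` [set i]) = (n%:R^-1)%:E
    & forall (s : seq nat) (E : nat -> set 'I_n), uniq s ->
        P (\bigcap_(k in [set` s]) (I k @^-1` E k)) =
        (\prod_(k <- s) P (I k @^-1` E k))%E].

Section SVRG.
Context {R : realType} {n m : nat}.
Variables (A : 'M[R]_(n, m)) (y : 'cV[R]_n).

Definition rowv (i : 'I_n) : 'cV[R]_m := (row i A)^T.

Definition normal_mx : 'M[R]_m := n%:R^-1 *: (A^T *m A).

(* The gradient of x |-> (2n)^-1 * l2norm (A x - y) ^ 2. *)
Definition lsq_grad (x : 'cV[R]_m) : 'cV[R]_m :=
  n%:R^-1 *: (A^T *m (A *m x - y)).

(* The recursion determines x uniquely, since k %/ M * M <= k. *)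
Definition is_svrg {T : Type} (c0 : R) (M : nat) (x0 : 'cV[R]_m)
    (I : nat -> T -> 'I_n) (x : nat -> T -> 'cV[R]_m) : Prop :=
  (forall t, x 0%N t = x0) /\
  forall k t, let xM := x (k %/ M * M)%N t in
    x k.+1 t = x k t - c0 *: (dotp (rowv (I k t)) (x k t - xM) *: rowv (I k t)
                              + lsq_grad xM).

End SVRG.

(* Main.v *)
(* Since A = Sigma V^T, the coordinates of the error in the orthonormal basis V
   decouple: the row a_i has a single nonzero coordinate, so in coordinate j,
   with lam the j-th eigenvalue of B and t = c0 lam, one epoch maps the error e
   to e - (lam e - zeta) W, where zeta is the noise coefficient and W is a random
   weight independent of e with lam E[W] = 1 - a and a = (1 - t)^M.
   Hence the mean and the second moment obey closed recursions. The variance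
   after K epochs is (lam e0 - zeta)^2 h_K with
   h_{K+1} = (a^2 + v lam^2) h_K + v a^{2K} and v = Var W
   <= n c0^2 sum_{i<M} (1 - (1 - t)^i)^2.
   The condition on cstar gives a^2 + v lam^2 <= a (1 - (1 - a) / cstar), whence
   both h_K <= v K (for the noise part) and a (1 - a) h_K <= v cstar a^K (for the
   part controlled by the source condition). The latter is combined with
   (1 - t)^N lam^s <= s^s (N c0)^(-s). *)
Require Import Defs.
From HB Require Import structures.
From mathcomp Require Import all_boot all_order all_algebra.
From mathcomp Require Import all_classical all_reals all_analysis.
From mathcomp Require Import ring lra.

Set Implicit Arguments.
Unset Strict Implicit.
Unset Printing Implicit Defensive.

Import Order.TTheory GRing.Theory Num.Theory.

Local Open Scope classical_set_scope.
Local Open Scope ring_scope.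

(** * Real estimates *)

Section RealEstimates.
Context {R : realType}.
Implicit Types a t r s x : R.

Lemma expr_1B_le_expR t N : 0 <= t <= 1 -> (1 - t) ^+ N <= expR (- (N%:R * t)).
Proof.
move=> /andP[t0 t1].
rewrite -mulrN expRM_natl.
rewrite lerXn2r ?nnegrE ?expR_ge0 ?subr_ge0//.
exact: expR_ge1Dx.
Qed.

Lemma expr_1B_mul1D_le t N : 0 <= t <= 1 -> (1 - t) ^+ N * (1 + N%:R * t) <= 1.
Proof.
move=> t01; elim: N => [|N IH]; first by rewrite expr0 mul0r addr0 mul1r.
have q0 : 0 <= (1 - t) ^+ N by rewrite exprn_ge0//; lra.
rewrite exprS -natr1.
have N0 : 0 <= N%:R :> R by [].
apply: le_trans IH; rewrite [_ * (1 - t) ^+ N]mulrC -mulrA ler_wpM2l//.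
have := mulr_ge0 N0 (sqr_ge0 t); have := sqr_ge0 t; nra.
Qed.

(** In closed form this is v times the sum over k < K of r^(K-1-k) q^k. *)
Fixpoint var_factor (r q v : R) (K : nat) : R :=
  if K is K'.+1 then r * var_factor r q v K' + v * q ^+ K' else 0.

Lemma var_factor_ge0 r q v K : 0 <= r -> 0 <= q -> 0 <= v ->
  0 <= var_factor r q v K.
Proof.
by move=> r0 q0 v0; elim: K => //= K IH; rewrite addr_ge0 ?mulr_ge0 ?exprn_ge0.
Qed.

Lemma var_factor_le r q v K : 0 <= r <= 1 -> 0 <= q <= 1 -> 0 <= v ->
  var_factor r q v K <= v * K%:R.
Proof.
move=> /andP[r0 r1] /andP[q0 q1] v0; elim: K => [|K IH]; first by rewrite mulr0.
rewrite -natr1 mulrDr mulr1 /=; apply: lerD; last by rewrite ler_piMr ?exprn_ile1.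
by apply: le_trans IH; rewrite ler_piMl ?var_factor_ge0.
Qed.

(** Induction on K. The condition on r leaves the slack a (1 - a) v a^K, which absorbs the new term
    a (1 - a) v a^(2K) because a^K <= 1. *)
Lemma var_factor_decay a c r v K : 0 <= a <= 1 -> 0 < c -> 0 <= r -> 0 <= v ->
  r * c <= a * (c - (1 - a)) ->
  a * (1 - a) * var_factor r (a ^+ 2) v K <= v * c * a ^+ K.
Proof.
move=> /andP[a0 a1] c0 r0 v0 hr; elim: K => [|K IH].
  by rewrite mulr0 mulr1 mulr_ge0// ltW.
rewrite /= mulrDr.
have aK : 0 <= a ^+ K by rewrite exprn_ge0.
have aK1 : a ^+ K <= 1 by rewrite exprn_ile1.
have h1 : r * (a * (1 - a) * var_factor r (a ^+ 2) v K) <=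
    v * a ^+ K * (a * (c - (1 - a))).
  apply: (le_trans (ler_wpM2l r0 IH)).
  rewrite (_ : r * (v * c * a ^+ K) = v * a ^+ K * (r * c)); last by ring.
  by rewrite ler_wpM2l// mulr_ge0.
have h2 : a * (1 - a) * (v * (a ^+ 2) ^+ K) <= v * a ^+ K * (a * (1 - a)).
  rewrite exprAC expr2.
  rewrite (_ : a * (1 - a) * (v * (a ^+ K * a ^+ K)) =
    v * a ^+ K * (a * (1 - a)) * a ^+ K); last by ring.
  by rewrite ler_piMr// !mulr_ge0// subr_ge0.
rewrite (_ : a * (1 - a) * (r * var_factor r (a ^+ 2) v K) =
  r * (a * (1 - a) * var_factor r (a ^+ 2) v K)); last by ring.
by rewrite (exprSr _ K); lra.
Qed.

(** The bracket after v equals lam^2 (s K - (p K)^2) + (lam p K - zeta)^2, and lam p K - zeta = a^K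
    (lam p 0 - zeta). So the variance s - p^2, up to the factor (lam p 0 - zeta)^2, obeys the
    recursion of [var_factor]. *)
Lemma second_moment_closed_form (a lam zeta mu v : R) (p s : nat -> R) K :
  lam * mu = 1 - a ->
  s 0%N = p 0%N ^+ 2 ->
  (forall K, p K.+1 = a * p K + zeta * mu) ->
  (forall K, s K.+1 = a ^+ 2 * s K + 2 * (a * zeta * mu) * p K + (zeta * mu) ^+ 2
     + v * (lam ^+ 2 * s K - 2 * (lam * zeta) * p K + zeta ^+ 2)) ->
  s K = p K ^+ 2 + (lam * p 0%N - zeta) ^+ 2 *
     var_factor (a ^+ 2 + v * lam ^+ 2) (a ^+ 2) v K.
Proof.
move=> lmu s0 pS sS.
have gK k : lam * p k - zeta = a ^+ k * (lam * p 0%N - zeta).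
  elim: k => [|k IH]; first by rewrite mul1r.
  rewrite pS exprS -mulrA -IH.
  by rewrite mulrDr mulrCA [lam * (zeta * _)]mulrCA lmu; ring.
elim: K => [|K IH]; first by rewrite mulr0 addr0.
rewrite sS pS /= IH.
have -> : (a ^+ 2) ^+ K = (a ^+ K) ^+ 2 by rewrite exprAC.
have := gK K; set h := var_factor _ _ _ _; set g := lam * p 0%N - zeta.
move=> e.
have -> : g ^+ 2 * ((a ^+ 2 + v * lam ^+ 2) * h + v * (a ^+ K) ^+ 2) =
  g ^+ 2 * ((a ^+ 2 + v * lam ^+ 2) * h) + v * (lam * p K - zeta) ^+ 2.
  by rewrite e; ring.
ring.
Qed.

(** The left side is (x exp(-x/s))^s, and 1 + x/s <= exp(x/s) gives x exp(-x/s) <= s. *)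
Lemma powR_expRN_le s x : 0 < s -> 0 <= x -> x `^ s * expR (- x) <= s `^ s.
Proof.
move=> s0 x0.
have -> : expR (- x) = expR (- (x / s)) `^ s.
  by rewrite -expRM mulNr mulfVK// gt_eqF.
rewrite -powRM ?expR_ge0// ge0_ler_powR ?nnegrE ?(ltW s0) ?mulr_ge0 ?expR_ge0//.
rewrite expRN ler_pdivrMr ?expR_gt0//.
have := expR_ge1Dx (x / s); rewrite -(ler_pM2l s0) mulrDr mulr1 mulrCA divff ?gt_eqF//.
rewrite mulr1; lra.
Qed.

Lemma powR_double x s : 0 <= x -> x `^ (2 * s) = (x `^ s) ^+ 2.
Proof. by move=> x0; rewrite mulrC powRrM powR_mulrn// powR_ge0. Qed.

Lemma expr_1B_powR_le (c lam s : R) N : 0 < c -> 0 <= lam -> c * lam <= 1 ->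
  0 < s -> (0 < N)%N ->
  (1 - c * lam) ^+ N * lam `^ s <= s `^ s * (N%:R * c) `^ (- s).
Proof.
move=> c0 l0 t1 s0 N0.
have Nc : 0 < N%:R * c by rewrite mulr_gt0// ltr0n.
rewrite powRN ler_pdivlMr ?powR_gt0// -mulrA -powRM ?(ltW Nc)//.
rewrite mulrC [lam * _]mulrC.
apply: le_trans (powR_expRN_le s0 (mulr_ge0 (ltW Nc) l0)).
by rewrite ler_wpM2l ?powR_ge0// -mulrA expr_1B_le_expR// t1 mulr_ge0// ltW.
Qed.

(** Both bounds are [expr_1B_powR_le] with exponent 2 nu. The first takes N = M K and keeps the
    factor 2^(2 nu) from (2 nu)^(2 nu); the second takes N = 2 M K, which cancels it. *)
Lemma source_rate (c lam nu : R) M K : 0 < c -> 0 <= lam -> c * lam <= 1 ->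
  0 < nu -> (0 < M)%N -> (0 < K)%N ->
  let cnu := nu `^ nu * (M%:R * c) `^ (- nu) in
  let a := (1 - c * lam) ^+ M in
  (a ^+ K * lam `^ (2 * nu) <= 2 `^ (2 * nu) * (cnu ^+ 2 * K%:R `^ (- (2 * nu))))
  /\ ((a ^+ K) ^+ 2 * lam `^ (2 * nu) <= cnu ^+ 2 * K%:R `^ (- (2 * nu))).
Proof.
move=> c0 l0 t1 nu0 M0 K0 cnu a.
have Mc : 0 < M%:R * c by rewrite mulr_gt0// ltr0n.
have n2 : 0 < 2 * nu by rewrite mulr_gt0.
have E : cnu ^+ 2 * K%:R `^ (- (2 * nu)) =
    nu `^ (2 * nu) * ((M * K)%:R * c) `^ (- (2 * nu)).
  rewrite /cnu exprMn -!powR_double ?(ltW nu0) ?(ltW Mc)// -mulrA mulrN.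
  rewrite -powRM ?(ltW Mc)//; congr (_ * _ `^ _); rewrite natrM; ring.
have MK : (0 < M * K)%N by rewrite muln_gt0 M0.
rewrite E; split.
  rewrite mulrA -powRM ?(ltW nu0)// /a -exprM.
  exact: expr_1B_powR_le.
rewrite /a -!exprM.
apply: le_trans (expr_1B_powR_le c0 l0 t1 n2 _) _; first by rewrite !muln_gt0 M0 K0.
have -> : (M * (K * 2))%:R * c = 2 * ((M * K)%:R * c) by rewrite !natrM; ring.
have MKc : 0 <= (M * K)%:R * c by rewrite mulr_ge0// ltW.
rewrite (powRM _ _ MKc)// (powRM _ _ (ltW nu0))//.
have : 2%:R `^ (2 * nu) * 2%:R `^ (- (2 * nu)) = 1 :> R.
  by rewrite -powRD ?subrr ?powRr0// pnatr_eq0 implybT.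
move=> h.
rewrite [leLHS](_ : _ = (2 `^ (2 * nu) * 2 `^ (- (2 * nu))) *
  (nu `^ (2 * nu) * ((M * K)%:R * c) `^ (- (2 * nu)))); last by ring.
by rewrite h mul1r.
Qed.

(** * Bias and variance bounds in one coordinate *)

Section CoordinateBound.
Variables (n M K : nat) (c0 lam L cstar v : R).
Hypotheses (hn : (0 < n)%N) (hM : (0 < M)%N) (c0_gt0 : 0 < c0).
Hypotheses (lam_ge0 : 0 <= lam) (lam_le : lam <= L) (cL : c0 * L < 1).
Hypothesis (cstar1 : 1 < cstar).

Let t := c0 * lam.
Let Z := M%:R * c0 * L.
Let a := (1 - t) ^+ M.
Let cB := (1 - c0 * L) ^- M.
Let sq_sum (u : R) := \sum_(1 <= i < M) (1 - (1 - u) ^+ i) ^+ 2.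
Let cstar2 := (3 + 2 * Z ^+ 2) * n%:R * M%:R * cB * c0 ^+ 2 * L.

Hypothesis hstar :
  (4 + 2 * Z ^+ 2) * n%:R * M%:R ^- 2 * cB * sq_sum (c0 * L) <= 1 - cstar^-1.
Hypothesis v_ge0 : 0 <= v.
Hypothesis v_le : v <= n%:R * c0 ^+ 2 * sq_sum t.

Let c0_ge0 : 0 <= c0. Proof. exact: ltW. Qed.
Let t_ge0 : 0 <= t. Proof. by rewrite mulr_ge0// ltW. Qed.
Let t_le : t <= c0 * L. Proof. by rewrite ler_wpM2l// ltW. Qed.
Let t_lt1 : t < 1. Proof. exact: le_lt_trans cL. Qed.
Let L_ge0 : 0 <= L. Proof. exact: le_trans lam_le. Qed.
Let u_ge0 : 0 <= 1 - t. Proof. by rewrite subr_ge0 ltW. Qed.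
Let u_le1 : 1 - t <= 1. Proof. by rewrite gerBl. Qed.
Let uL_ge0 : 0 <= 1 - c0 * L. Proof. by rewrite subr_ge0 ltW. Qed.
Let uL_le : 1 - c0 * L <= 1 - t. Proof. by rewrite lerD2l lerN2. Qed.
Let a_gt0 : 0 < a. Proof. by rewrite exprn_gt0// subr_gt0. Qed.
Let a_ge0 : 0 <= a. Proof. exact: ltW. Qed.
Let cstar_ge0 : 0 <= cstar. Proof. by apply: ltW; exact: lt_trans cstar1. Qed.
Let a_le1 : a <= 1. Proof. by rewrite exprn_ile1. Qed.

(** Since lam <= L, a >= (1 - c0 L)^M: a factor a can be inserted into an upper bound at the price
    of [cB]. *)
Let cBa : 1 <= cB * a.
Proof.
rewrite mulrC ler_pdivlMr ?exprn_gt0 ?subr_gt0// mul1r.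
by apply: lerXn2r; rewrite ?nnegrE.
Qed.

Let cB_ge0 : 0 <= cB.
Proof. by rewrite invr_ge0 exprn_ge0// subr_ge0 ltW. Qed.

Let cB_ge1 : 1 <= cB.
Proof. by apply: le_trans cBa _; rewrite ler_piMr. Qed.

Let sq_sum_le : sq_sum t <= sq_sum (c0 * L).
Proof.
apply: ler_sum => i _; apply: lerXn2r; rewrite ?nnegrE ?subr_ge0.
- by rewrite exprn_ile1.
- by rewrite exprn_ile1// (le_trans uL_le).
- by rewrite lerD2l lerN2; apply: lerXn2r; rewrite ?nnegrE.
Qed.

(** For i < M, (1 - t)^i >= a. The factors 1 - a gained here later cancel the one in
    [var_factor_decay]. *)
Let sq_sum_le1Ba : sq_sum t <= M%:R * (1 - a) ^+ 2.
Proof.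
have h : sq_sum t <= \sum_(1 <= i < M) (1 - a) ^+ 2.
  rewrite /sq_sum big_nat_cond [leRHS]big_nat_cond.
  apply: ler_sum => i /andP[/andP[i1 iM] _].
  apply: lerXn2r; rewrite ?nnegrE.
  - by rewrite subr_ge0 exprn_ile1.
  - by rewrite subr_ge0.
  - by rewrite lerD2l lerN2 /a; apply: ler_wiXn2l => //; exact: ltnW.
apply: (le_trans h); rewrite sumr_const_nat -[leLHS]mulr_natl ler_wpM2r ?sqr_ge0//.
by rewrite ler_nat leq_subr.
Qed.

Let sq_sum_ge0 u : 0 <= sq_sum u.
Proof. by apply: sumr_ge0 => i _; rewrite sqr_ge0. Qed.

Let r := a ^+ 2 + v * lam ^+ 2.

(* With z = M t, the hypothesis on cstar gives
   v lam^2 <= (1 - 1/cstar) a z^2 / (4 + 2 z^2), and z (1 + z) <= 4 + 2 z^2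
   together with Bernoulli's inequality a (1 + z) <= 1 gives
   z^2 / (4 + 2 z^2) <= 1 - a. *)
Lemma epoch_variance_le : v * lam ^+ 2 * cstar <= a * (1 - a) * (cstar - 1).
Proof.
set z := M%:R * t.
have z0 : 0 <= z by rewrite mulr_ge0.
have zZ : z <= Z by rewrite /z /Z -mulrA ler_wpM2l.
have hz : z <= (1 - a) * (1 + z).
  have := @expr_1B_mul1D_le t M; rewrite -/a -/z.
  by rewrite t_ge0 (ltW t_lt1) => /(_ isT); lra.
have cs0 : 0 < cstar by exact: lt_trans cstar1.
have M0 : 0 < M%:R :> R by rewrite ltr0n.
have n0 : 0 < n%:R :> R by rewrite ltr0n.
have hst : (4 + 2 * Z ^+ 2) * n%:R * cB * sq_sum (c0 * L) * cstar <=
    (cstar - 1) * M%:R ^+ 2.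
  move: hstar; rewrite -(ler_pM2r cs0) mulrBl mulVf ?gt_eqF// mul1r.
  rewrite -(ler_pM2r (exprn_gt0 2 M0)); apply: le_trans.
  by rewrite le_eqVlt; apply/orP; left; apply/eqP; field; rewrite gt_eqF.
have hv : v * lam ^+ 2 <= n%:R * t ^+ 2 * sq_sum t.
  rewrite [leRHS](_ : _ = n%:R * c0 ^+ 2 * sq_sum t * lam ^+ 2); last first.
    by rewrite /t; ring.
  by rewrite ler_wpM2r// sqr_ge0.
have hv2 : v * lam ^+ 2 <= n%:R * t ^+ 2 * sq_sum (c0 * L) * (cB * a).
  apply: (le_trans hv); apply: (@le_trans _ _ (n%:R * t ^+ 2 * sq_sum (c0 * L))).
    by rewrite ler_wpM2l// mulr_ge0 ?sqr_ge0// ltW.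
  by rewrite ler_peMr// !mulr_ge0 ?sqr_ge0// ltW.
have hv3 : v * lam ^+ 2 * cstar * (4 + 2 * z ^+ 2) <= z ^+ 2 * a * (cstar - 1).
  apply: (@le_trans _ _ (n%:R * t ^+ 2 * sq_sum (c0 * L) * (cB * a) * cstar * (4 + 2 * Z ^+ 2))).
    apply: ler_pM.
    - by rewrite !mulr_ge0 ?sqr_ge0// ltW.
    - by rewrite addr_ge0// mulr_ge0// sqr_ge0.
    - by rewrite ler_wpM2r// ltW.
    - by rewrite lerD2l ler_wpM2l// lerXn2r// nnegrE// (le_trans z0).
  rewrite [leLHS](_ : _ = t ^+ 2 * a *
    ((4 + 2 * Z ^+ 2) * n%:R * cB * sq_sum (c0 * L) * cstar)); last by ring.
  rewrite [leRHS](_ : _ = t ^+ 2 * a * ((cstar - 1) * M%:R ^+ 2)); last by rewrite /z; ring.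
  by rewrite ler_wpM2l// mulr_ge0 ?sqr_ge0// ltW.
have z4 : 0 < 4 + 2 * z ^+ 2 by have := sqr_ge0 z; lra.
rewrite -(ler_pM2r z4); apply: (le_trans hv3).
rewrite [leRHS](_ : _ = (1 - a) * (4 + 2 * z ^+ 2) * a * (cstar - 1)); last by ring.
apply: ler_wpM2r; first by rewrite subr_ge0 ltW.
apply: ler_wpM2r; first exact: ltW.
apply: (@le_trans _ _ ((1 - a) * (1 + z) * z)).
  by rewrite expr2 ler_wpM2r.
rewrite -mulrA ler_wpM2l ?subr_ge0//.
have := sqr_ge0 (z - 1); rewrite !expr2; nra.
Qed.

Let r_ge0 : 0 <= r.
Proof. exact: addr_ge0 (sqr_ge0 _) (mulr_ge0 v_ge0 (sqr_ge0 _)). Qed.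

Let r_cstar : r * cstar <= a * (cstar - (1 - a)).
Proof. by have := epoch_variance_le; rewrite /r mulrDl expr2; lra. Qed.

Let r_le1 : r <= 1.
Proof.
have cs0 : 0 < cstar by exact: lt_trans cstar1.
rewrite -(ler_pM2r cs0) mul1r (le_trans r_cstar)//.
have h1 : 0 <= (1 - a) * cstar by rewrite mulr_ge0 ?subr_ge0// ltW.
have h2 : 0 <= a * (1 - a) by rewrite mulr_ge0 ?subr_ge0// ltW.
lra.
Qed.

Let h := var_factor r (a ^+ 2) v K.

Let h_ge0 : 0 <= h.
Proof. by rewrite var_factor_ge0 ?sqr_ge0. Qed.

Let Z2 : 0 <= Z ^+ 2. Proof. exact: sqr_ge0. Qed.
Let nc_ge0 : 0 <= n%:R * c0 ^+ 2. Proof. by rewrite mulr_ge0// sqr_ge0. Qed.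
Let cstar2_ge0 : 0 <= cstar2.
Proof.
have Z3 : 0 <= 3 + 2 * Z ^+ 2 by rewrite addr_ge0// mulr_ge0.
by rewrite /cstar2 !mulr_ge0 ?sqr_ge0// ltW.
Qed.

(** Uses h <= v K and v <= n c0^2 M; the factor 2 is absorbed by 3 + 2 Z^2, while [cB] and [cstar]
    are at least 1. *)
Lemma noise_var_factor_le : 2 * lam * h <= cstar2 * cstar * K%:R.
Proof.
have hh : h <= v * K%:R.
  apply: var_factor_le => //; first by rewrite r_ge0 r_le1.
  by rewrite sqr_ge0 exprn_ile1// ltW.
have hv : v <= n%:R * c0 ^+ 2 * M%:R.
  apply: (le_trans v_le); rewrite ler_wpM2l//.
  apply: (le_trans sq_sum_le1Ba); by rewrite ler_piMr// exprn_ile1 ?subr_ge0// gerBl ltW.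
have : 2 * lam * h <= 2 * L * (n%:R * c0 ^+ 2 * M%:R * K%:R).
  apply: ler_pM => //; first by rewrite mulr_ge0.
  - by rewrite ler_wpM2l.
  - by apply: (le_trans hh); rewrite ler_wpM2r.
move/le_trans; apply.
rewrite [leLHS](_ : _ = 2 * (n%:R * M%:R * c0 ^+ 2 * L * K%:R)); last by ring.
rewrite [leRHS](_ : _ = ((3 + 2 * Z ^+ 2) * cB * cstar) *
  (n%:R * M%:R * c0 ^+ 2 * L * K%:R)); last by rewrite /cstar2; ring.
apply: ler_wpM2r; first by rewrite !mulr_ge0 ?sqr_ge0.
have h1 : 1 <= cB * cstar by rewrite mulr_ege1// ltW.
have h2 : 2 * 1 <= (3 + 2 * Z ^+ 2) * (cB * cstar) by apply: ler_pM => //; have := Z2; lra.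
by rewrite -mulrA; move: h2; rewrite mulr1.
Qed.

(** In the decay bound a (1 - a) multiplies h. The factor 1 - a is compensated by v <= n c0^2 M (1 -
    a), the factor a by 1 <= cB a. *)
Lemma source_var_factor_le : 2 * lam ^+ 2 * h <= L * cstar2 * cstar * a ^+ K.
Proof.
have cs0 : 0 < cstar by exact: lt_trans cstar1.
have RHS0 : 0 <= L * cstar2 * cstar * a ^+ K.
  by apply: mulr_ge0 (mulr_ge0 (mulr_ge0 _ _) _) _; rewrite ?exprn_ge0.
(* For a = 1 nothing can be cancelled, but then 1 = (1 - t)^M <= 1 - t forces t = 0, hence lam =
   0. *)
have [a1|a1] := eqVneq a 1.
  have lam0 : lam = 0.
    have : t ^+ 1 = 0.
      apply/eqP; rewrite expr1 eq_le t_ge0 andbT.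
      have : (1 - t) ^+ M <= (1 - t) ^+ 1 by apply: ler_wiXn2l.
      by rewrite -/a a1 expr1; lra.
    by move/eqP; rewrite expr1 mulf_eq0 gt_eqF//= => /eqP.
  by rewrite lam0 expr0n/= mulr0 mul0r.
have a1lt : 0 < a * (1 - a) by rewrite mulr_gt0// subr_gt0 lt_neqAle a1.
have hdec : a * (1 - a) * h <= v * cstar * a ^+ K.
  by apply: var_factor_decay => //; rewrite (ltW a_gt0).
rewrite -(ler_pM2l a1lt).
rewrite [leLHS](_ : _ = 2 * lam ^+ 2 * (a * (1 - a) * h)); last by ring.
apply: (@le_trans _ _ (2 * lam ^+ 2 * (v * cstar * a ^+ K))).
  by rewrite ler_wpM2l// mulr_ge0 ?sqr_ge0.
rewrite [leLHS](_ : _ = (2 * lam ^+ 2 * v) * (cstar * a ^+ K)); last by ring.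
rewrite [leRHS](_ : _ = (a * (1 - a) * (L * cstar2)) * (cstar * a ^+ K)); last by ring.
apply: ler_wpM2r; first by rewrite mulr_ge0 ?exprn_ge0.
have hv : v <= n%:R * c0 ^+ 2 * (M%:R * (1 - a)).
  apply: (le_trans v_le); rewrite ler_wpM2l//.
  apply: (le_trans sq_sum_le1Ba); rewrite ler_wpM2l// expr2 ler_piMr ?subr_ge0//.
  by have := a_gt0; lra.
apply: (@le_trans _ _ (2 * L ^+ 2 * (n%:R * c0 ^+ 2 * (M%:R * (1 - a))))).
  apply: ler_pM => //; first by rewrite mulr_ge0 ?sqr_ge0.
  by rewrite ler_wpM2l// lerXn2r.
rewrite [leLHS](_ : _ = 2 * (n%:R * M%:R * c0 ^+ 2 * L ^+ 2 * (1 - a))); last by ring.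
rewrite [leRHS](_ : _ = ((3 + 2 * Z ^+ 2) * (cB * a)) *
  (n%:R * M%:R * c0 ^+ 2 * L ^+ 2 * (1 - a))); last by rewrite /cstar2; ring.
apply: ler_wpM2r; first by rewrite !mulr_ge0 ?sqr_ge0// subr_ge0.
have h2 : 2 * 1 <= (3 + 2 * Z ^+ 2) * (cB * a) by apply: ler_pM => //; have := Z2; lra.
by move: h2; rewrite mulr1.
Qed.

(** Bias and variance are each split into a source part and a noise part by (x + y)^2 <= 2 x^2 + 2
    y^2: [T1] and [T2] bound the bias, [T3] and [T4] the variance. *)
Lemma coordinate_second_moment_le (nu p0 w zeta Xi kap s : R) :
  (0 < K)%N -> 0 < nu ->
  p0 ^+ 2 = lam `^ (2 * nu) * w ^+ 2 ->
  n%:R * zeta ^+ 2 <= lam * Xi -> 0 <= Xi ->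
  lam * kap = 1 - a ^+ K -> 0 <= kap <= K%:R * M%:R * c0 ->
  s = (a ^+ K * p0 + zeta * kap) ^+ 2 + (lam * p0 - zeta) ^+ 2 * h ->
  s <= (2 + 2 `^ (2 * nu) * L * cstar2 * cstar)
        * (nu `^ nu * (M%:R * c0) `^ (- nu)) ^+ 2 * K%:R `^ (- (2 * nu)) * w ^+ 2
     + (2 * M%:R * c0 + cstar2 * cstar) * K%:R * (n%:R^-1 * Xi).
Proof.
move=> K0 nu0 p0E zetaE Xi0 kapE /andP[kap0 kap1] sE.
set cnu := nu `^ nu * _.
have n0 : 0 < n%:R :> R by rewrite ltr0n.
have zle : zeta ^+ 2 <= lam * (n%:R^-1 * Xi).
  by rewrite mulrCA -(ler_pM2l n0) mulVKf// gt_eqF.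
set X := n%:R^-1 * Xi in zle *.
have X0 : 0 <= X by rewrite mulr_ge0// invr_ge0 ltW.
have [B1 B2] := source_rate c0_gt0 lam_ge0 (ltW t_lt1) nu0 hM K0.
rewrite -/cnu -/t -/a in B1 B2.
set rate := cnu ^+ 2 * K%:R `^ (- (2 * nu)) in B1 B2.
have aK0 : 0 <= a ^+ K by rewrite exprn_ge0// ltW.
have T1 : 2 * (a ^+ K * p0) ^+ 2 <= 2 * rate * w ^+ 2.
  rewrite exprMn p0E mulrA mulrA ler_wpM2r ?sqr_ge0// -mulrA ler_wpM2l//.
have T2 : 2 * (zeta * kap) ^+ 2 <= 2 * M%:R * c0 * K%:R * X.
  rewrite exprMn.
  apply: (@le_trans _ _ (2 * (lam * X * kap ^+ 2))).
    by rewrite ler_wpM2l// ler_wpM2r ?sqr_ge0.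
  (* One factor kap is spent on lam kap = 1 - a^K <= 1, so the noise grows only linearly in K. *)
  rewrite [leLHS](_ : _ = 2 * X * ((lam * kap) * kap)); last by ring.
  rewrite [leRHS](_ : _ = 2 * X * (K%:R * M%:R * c0)); last by ring.
  rewrite ler_wpM2l ?mulr_ge0//; apply: le_trans kap1.
  by rewrite ler_piMl// kapE; lra.
have T3 : 2 * (lam * p0) ^+ 2 * h <= 2 `^ (2 * nu) * L * cstar2 * cstar * rate * w ^+ 2.
  rewrite exprMn p0E.
  rewrite [leLHS](_ : _ = (2 * lam ^+ 2 * h) * lam `^ (2 * nu) * w ^+ 2); last by ring.
  rewrite ler_wpM2r ?sqr_ge0//.
  apply: (@le_trans _ _ (L * cstar2 * cstar * a ^+ K * lam `^ (2 * nu))).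
    by rewrite ler_wpM2r ?powR_ge0// source_var_factor_le.
  rewrite [leRHS](_ : _ = L * cstar2 * cstar * (2 `^ (2 * nu) * rate)); last by ring.
  by rewrite -mulrA ler_wpM2l// mulr_ge0// mulr_ge0.
have T4 : 2 * zeta ^+ 2 * h <= cstar2 * cstar * K%:R * X.
  apply: (@le_trans _ _ (2 * lam * h * X)).
    rewrite [leRHS](_ : _ = 2 * (lam * X) * h); last by ring.
    by rewrite ler_wpM2r// ler_wpM2l.
  by rewrite ler_wpM2r// noise_var_factor_le.
have sq2 (x y : R) : (x + y) ^+ 2 <= 2 * x ^+ 2 + 2 * y ^+ 2.
  by have := sqr_ge0 (x - y); rewrite !expr2; lra.
have S1 := sq2 (a ^+ K * p0) (zeta * kap).
have S2 : (lam * p0 - zeta) ^+ 2 * h <= 2 * (lam * p0) ^+ 2 * h + 2 * zeta ^+ 2 * h.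
  by rewrite -mulrDl ler_wpM2r//; have := sq2 (lam * p0) (- zeta); rewrite sqrrN.
rewrite sE [leRHS](_ : _ = 2 * rate * w ^+ 2 + 2 * M%:R * c0 * K%:R * X +
  2 `^ (2 * nu) * L * cstar2 * cstar * rate * w ^+ 2 + cstar2 * cstar * K%:R * X).
  lra.
by rewrite /rate; ring.
Qed.

End CoordinateBound.
End RealEstimates.

(** * The error recursion in one coordinate *)

Section UniformAverage.
Context {R : realType} {n : nat}.
Hypothesis n_gt0 : (0 < n)%N.
Implicit Types (F G : seq 'I_n -> R) (s : seq 'I_n).

(** The expectation of F over k independent uniform draws. The head is the latest draw and is
    averaged first, with the earlier draws fixed. *)
Fixpoint avg k F : R :=
  if k is k'.+1 then avg k' (fun s => n%:R^-1 * \sum_i F (i :: s)) else F [::].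

Lemma eq_avg k F G : (forall s, size s = k -> F s = G s) -> avg k F = avg k G.
Proof.
elim: k F G => [|k IH] F G FG /=; first exact: FG.
apply: IH => s sk; congr (_ * _); apply: eq_bigr => i _.
by rewrite FG//= sk.
Qed.

Lemma avg_linear k c F G :
  avg k (fun s => c * F s + G s) = c * avg k F + avg k G.
Proof.
elim: k F G => [//|k IH] F G /=; rewrite -IH; apply: eq_avg => s _.
by rewrite big_split/= -mulr_sumr mulrDr mulrCA.
Qed.

Lemma mean_cst c : n%:R^-1 * (\sum_(i < n) c) = c :> R.
Proof.
by rewrite sumr_const card_ord -[c *+ n]mulr_natl mulKf// pnatr_eq0 -lt0n.
Qed.

Lemma avg_cst k c : avg k (fun=> c) = c.
Proof.
elim: k => //= k IH; rewrite -[RHS]IH; apply: eq_avg => s _; exact: mean_cst.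
Qed.

Lemma avg_sum k (J : finType) (F : J -> seq 'I_n -> R) :
  avg k (fun s => \sum_j F j s) = \sum_j avg k (F j).
Proof.
elim: k F => [//|k IH] F /=; rewrite -IH; apply: eq_avg => s _.
by rewrite exchange_big/= mulr_sumr.
Qed.

Lemma avg_quad k c2 c1 c F :
  avg k (fun s => c2 * F s ^+ 2 + (c1 * F s + c)) =
  c2 * avg k (fun s => F s ^+ 2) + (c1 * avg k F + c).
Proof. by rewrite !avg_linear avg_cst. Qed.

(** The tower property: the inner average is conditional on the older draws [s]. It is applied with
    l = M, one epoch. *)
Lemma avg_cat l k F :
  avg (l + k) F = avg k (fun s => avg l (fun s' => F (s' ++ s))).
Proof. by elim: l F => [//|l IH] F; rewrite addSn /= IH. Qed.

Lemma avg_tuple k F : avg k F = n%:R^-1 ^+ k * \sum_(s : k.-tuple 'I_n) F s.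
Proof.
elim: k F => [|k IH] F /=.
  rewrite mul1r (bigD1 [tuple])//= big1 ?addr0// => s /eqP[].
  exact: tuple0.
rewrite IH -mulr_sumr mulrA -exprSr; congr (_ * _).
rewrite exchange_big/= pair_big/=.
rewrite (reindex (fun p : 'I_n * k.-tuple 'I_n => [tuple of p.1 :: p.2]))//=.
exists (fun s : k.+1.-tuple 'I_n => (thead s, [tuple of behead s])).
  by move=> [i s] _; congr (_, _); apply: val_inj.
by move=> s _; rewrite -tuple_eta.
Qed.

(** * Mean and variance of the epoch weight *)

Section Epoch.
Variables (b : 'I_n -> R) (c0 lam : R).
(** In the application b_i is the squared entry (i, j) of Sigma: at most one b_i is nonzero and it
    equals n lam, whence the second moment n lam^2. *)
Hypothesis mean_b : n%:R^-1 * (\sum_i b i) = lam.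
Hypothesis mean_b2 : n%:R^-1 * (\sum_i b i ^+ 2) = n%:R * lam ^+ 2.
Hypotheses (c0_ge0 : 0 <= c0) (lam_ge0 : 0 <= lam).
Hypothesis step_le : n%:R * (c0 * lam) <= 1.
Let t := c0 * lam.

(* Along one coordinate, u := (iterate - anchor) evolves over an epoch by
   u' = (1 - c0 b_i) u - c0 g, where g = lam e - zeta depends only on the error
   e of the anchor; hence u = - g * epoch_weight s, s being the list of indices
   drawn so far in the epoch, the last one first. *)
Fixpoint epoch_weight s : R :=
  if s is i :: s' then (1 - c0 * b i) * epoch_weight s' + c0 else 0.

Let mu k := avg k epoch_weight.
Let v k := avg k (fun s => epoch_weight s ^+ 2) - mu k ^+ 2.

Let t_ge0 : 0 <= t. Proof. exact: mulr_ge0. Qed.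
Let t_le1 : t <= 1.
Proof. by apply: le_trans step_le; rewrite ler_peMl// ler1n. Qed.

Lemma mean_epoch_weightS k : mu k.+1 = (1 - t) * mu k + c0.
Proof.
rewrite /mu /= -[X in _ = _ + X](@avg_cst k) -avg_linear; apply: eq_avg => s _.
rewrite big_split/= -mulr_suml mulrDr mean_cst mulrA; congr (_ * _ + _).
by rewrite sumrB mulrBr mean_cst -mulr_sumr mulrCA mean_b.
Qed.

(** With X = 1 - c0 b_i independent of W, Var(X W + c0) = E[X^2] Var W + Var X (E W)^2, where E[X^2]
    = 1 - 2 t + n t^2 and Var X = (n - 1) t^2. *)
Lemma var_epoch_weightS k :
  v k.+1 = (1 - 2 * t + n%:R * t ^+ 2) * v k + (n%:R - 1) * (t * mu k) ^+ 2.
Proof.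
have -> : v k.+1 = (1 - 2 * t + n%:R * t ^+ 2) * avg k (fun s => epoch_weight s ^+ 2) +
    (2 * c0 * (1 - t) * mu k + c0 ^+ 2) - mu k.+1 ^+ 2.
  rewrite -avg_quad /v; congr (_ - _); rewrite [LHS]/=; apply: eq_avg => s _ /=.
  set w := epoch_weight s.
  under eq_bigr => i _.
    rewrite (_ : _ ^+ 2 = (w ^+ 2 + (2 * c0 * w + c0 ^+ 2)) +
      ((- 2 * c0 * w ^+ 2 - 2 * c0 ^+ 2 * w) * b i + c0 ^+ 2 * w ^+ 2 * b i ^+ 2)); last by ring.
    over.
  rewrite big_split/= [X in _ * (_ + X)]big_split/= -!mulr_sumr !mulrDr mean_cst.
  rewrite (mulrCA _ _ (\sum_i b i)) (mulrCA _ _ (\sum_i b i ^+ 2)) mean_b mean_b2 /t; ring.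
rewrite mean_epoch_weightS /v; ring.
Qed.

Lemma mean_epoch_weightE k : lam * mu k = 1 - (1 - t) ^+ k.
Proof.
elim: k => [|k IH]; first by rewrite mulr0 subrr.
by rewrite mean_epoch_weightS mulrDr mulrCA IH exprS /t; ring.
Qed.

Lemma mean_epoch_weight_ge0 k : 0 <= mu k.
Proof.
elim: k => [//|k IH].
by rewrite mean_epoch_weightS addr_ge0 ?mulr_ge0 ?subr_ge0.
Qed.

Lemma mean_epoch_weight_le k : mu k <= k%:R * c0.
Proof.
elim: k => [|k IH]; first by rewrite mul0r.
rewrite mean_epoch_weightS -natr1 [leRHS]mulrDl mul1r lerD2r; apply: le_trans IH.
by rewrite ler_piMl ?mean_epoch_weight_ge0// gerBl.
Qed.

Let rho_ge0 : 0 <= 1 - 2 * t + n%:R * t ^+ 2.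
Proof.
have : 0 <= (n%:R - 1) * t ^+ 2 by rewrite mulr_ge0 ?sqr_ge0// subr_ge0 ler1n.
by have := sqr_ge0 (1 - t); rewrite !expr2; lra.
Qed.

(** The step size condition n t <= 1 gives n t^2 <= t, so a step does not amplify the variance
    already present. *)
Let rho_le1 : 1 - 2 * t + n%:R * t ^+ 2 <= 1.
Proof.
by rewrite expr2 mulrA; have := ler_wpM2r t_ge0 step_le; rewrite -/t; have := t_ge0; lra.
Qed.

Lemma var_epoch_weight_ge0 k : 0 <= v k.
Proof.
elim: k => [|k IH]; first by rewrite /v/mu/= subrr.
rewrite var_epoch_weightS; apply: addr_ge0; first exact: mulr_ge0.
by rewrite mulr_ge0 ?sqr_ge0// subr_ge0 ler1n.
Qed.

(** Step k adds at most n (t mu_k)^2, and t mu_k = c0 (1 - (1 - t)^k). *)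
Lemma var_epoch_weight_le k :
  v k <= n%:R * c0 ^+ 2 * \sum_(0 <= i < k) (1 - (1 - t) ^+ i) ^+ 2.
Proof.
elim: k => [|k IH]; first by rewrite big_nil mulr0 /v/mu/= subrr.
rewrite big_nat_recr//= mulrDr var_epoch_weightS; apply: lerD.
  apply: le_trans IH; rewrite ler_piMl//; exact: var_epoch_weight_ge0.
rewrite -mean_epoch_weightE /t -mulrA exprMn mulrA ler_wpM2r ?sqr_ge0//.
by rewrite ler_wpM2r ?sqr_ge0// gerBl.
Qed.

(** * Mean and second moment of the error after K epochs *)

Section Error.
Variables (M : nat) (zeta e0 : R).

(** With the latest draw first, [take M s] is the last epoch and [drop M s] the earlier ones. *)
Fixpoint epoch_error K s : R :=
  if K is K'.+1 then
    let e := epoch_error K' (drop M s) in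
    e - (lam * e - zeta) * epoch_weight (take M s)
  else e0.

Let a := (1 - t) ^+ M.
Let p K := avg (K * M) (epoch_error K).
Let q K := avg (K * M) (fun s => epoch_error K s ^+ 2).

Lemma epoch_error_cat K s s' : size s' = M ->
  epoch_error K.+1 (s' ++ s) =
  epoch_error K s - (lam * epoch_error K s - zeta) * epoch_weight s'.
Proof. by move=> sM; rewrite /= drop_size_cat// take_size_cat. Qed.

Lemma mean_epoch_errorS K : p K.+1 = a * p K + zeta * mu M.
Proof.
have aE : a = 1 - lam * mu M by rewrite mean_epoch_weightE subKr.
rewrite /p mulSn avg_cat -[zeta * _](@avg_cst (K * M)) -avg_linear.
apply: eq_avg => s _; set e := epoch_error K s.
rewrite (@eq_avg _ _ (fun s' => - (lam * e - zeta) * epoch_weight s' + e)).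
  by rewrite avg_linear avg_cst -/(mu M) aE; ring.
by move=> s' sM; rewrite epoch_error_cat// -/e; ring.
Qed.

(** Given the previous error e and g = lam e - zeta, the conditional second moment of e - g W is (e
    - g mu)^2 + v g^2, and e - g mu = a e + zeta mu. *)
Lemma sq_epoch_errorS K : q K.+1 = a ^+ 2 * q K + 2 * (a * zeta * mu M) * p K
  + (zeta * mu M) ^+ 2
  + v M * (lam ^+ 2 * q K - 2 * (lam * zeta) * p K + zeta ^+ 2).
Proof.
have aE : a = 1 - lam * mu M by rewrite mean_epoch_weightE subKr.
rewrite [RHS](_ : _ = (a ^+ 2 + v M * lam ^+ 2) * q K +
  ((2 * (a * zeta * mu M) - 2 * v M * lam * zeta) * p K +
   ((zeta * mu M) ^+ 2 + v M * zeta ^+ 2))); last by ring.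
rewrite /q /p mulSn avg_cat -avg_quad.
apply: eq_avg => s _; set e := epoch_error K s.
rewrite (@eq_avg _ _ (fun s' => (lam * e - zeta) ^+ 2 * epoch_weight s' ^+ 2 +
   (- 2 * e * (lam * e - zeta) * epoch_weight s' + e ^+ 2))).
  by rewrite avg_quad -/(mu M) aE /v; ring.
by move=> s' sM; rewrite epoch_error_cat// -/e; ring.
Qed.

(** Here kap = mu (1 + a + ... + a^(K-1)); the quotient (1 - a^K) / lam is avoided because lam may
    vanish. *)
Lemma mean_epoch_errorE K : exists kap,
  [/\ p K = a ^+ K * e0 + zeta * kap, lam * kap = 1 - a ^+ K
    & 0 <= kap <= K%:R * M%:R * c0].
Proof.
have a0 : 0 <= a by rewrite exprn_ge0 ?subr_ge0.
have a1 : a <= 1 by rewrite exprn_ile1 ?subr_ge0// gerBl.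
elim: K => [|K [kap [pE kapE /andP[kap0 kap1]]]].
  by exists 0; rewrite /p/= expr0 !mulr0 addr0 mul1r subrr !mul0r lexx.
exists (a * kap + mu M); split.
- by rewrite mean_epoch_errorS pE exprS; ring.
- by rewrite mulrDr mulrCA kapE mean_epoch_weightE -/a exprS; ring.
- rewrite addr_ge0 ?mulr_ge0 ?mean_epoch_weight_ge0//= -natr1 2!mulrDl mul1r.
  apply: lerD; last exact: mean_epoch_weight_le.
  by apply: le_trans kap1; rewrite ler_piMl.
Qed.

Lemma sq_epoch_errorE K : q K =
  p K ^+ 2 + (lam * e0 - zeta) ^+ 2 *
    var_factor (a ^+ 2 + v M * lam ^+ 2) (a ^+ 2) (v M) K.
Proof.
apply: (@second_moment_closed_form _ a lam zeta (mu M) (v M) p q K).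
- by rewrite mean_epoch_weightE.
- by [].
- exact: mean_epoch_errorS.
- exact: sq_epoch_errorS.
Qed.

End Error.
End Epoch.

Lemma avg_sq_epoch_error_le (b : 'I_n -> R) (M K : nat)
    (c0 lam L cstar nu zeta e0 w Xi : R) :
  n%:R^-1 * (\sum_i b i) = lam ->
  n%:R^-1 * (\sum_i b i ^+ 2) = n%:R * lam ^+ 2 ->
  0 < c0 -> 0 <= lam <= L -> n%:R * (c0 * lam) <= 1 -> c0 * L < 1 ->
  (0 < M)%N -> (0 < K)%N -> 0 < nu -> 1 < cstar ->
  let cB := (1 - c0 * L) ^- M in
  let cBM := \sum_(1 <= i < M) (1 - (1 - c0 * L) ^+ i) ^+ 2 in
  let cnu := nu `^ nu * (M%:R * c0) `^ (- nu) in
  let cstar2 := (3 + 2 * (M%:R * c0 * L) ^+ 2) * n%:R * M%:R * cB * c0 ^+ 2 * L in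
  (4 + 2 * (M%:R * c0 * L) ^+ 2) * n%:R * M%:R ^- 2 * cB * cBM <= 1 - cstar^-1 ->
  e0 ^+ 2 = lam `^ (2 * nu) * w ^+ 2 ->
  n%:R * zeta ^+ 2 <= lam * Xi -> 0 <= Xi ->
  avg (K * M) (fun s => epoch_error b c0 lam M zeta e0 K s ^+ 2) <=
    (2 + 2 `^ (2 * nu) * L * cstar2 * cstar)
      * cnu ^+ 2 * K%:R `^ (- (2 * nu)) * w ^+ 2
    + (2 * M%:R * c0 + cstar2 * cstar) * K%:R * (n%:R^-1 * Xi).
Proof.
move=> mb mb2 c00 /andP[l0 lL] st cL M0 K0 nu0 cs1 cB cBM cnu cstar2 hstar e0E zE Xi0.
have c0' := ltW c00.
have v0 := var_epoch_weight_ge0 c0 mb mb2 M.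
have vle := var_epoch_weight_le mb mb2 c0' l0 st M.
(* The variance bound sums from i = 0, [cBM] from i = 1; the term i = 0 is zero. *)
rewrite big_ltn// expr0 subrr expr0n/= add0r in vle.
have [kap [pE kapE kap01]] := mean_epoch_errorE mb c0' l0 st M zeta e0 K.
apply: (coordinate_second_moment_le n_gt0 M0 c00 l0 lL cL cs1 hstar v0 vle
  K0 nu0 e0E zE Xi0 kapE kap01).
by rewrite -pE (sq_epoch_errorE c0 mb).
Qed.

End UniformAverage.

(** * The law of the index sequence *)

Section History.
Context {n : nat} {T : Type}.
Variable I : nat -> T -> 'I_n.

Definition history k (t : T) : seq 'I_n := rev (mkseq (I^~ t) k).

Lemma historyS k t : history k.+1 t = I k t :: history k t.
Proof. by rewrite /history mkseqS rev_rcons. Qed.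

Lemma size_history k t : size (history k t) = k.
Proof. by rewrite size_rev size_mkseq. Qed.

Lemma drop_history k i t : drop i (history (k + i) t) = history k t.
Proof. by elim: i => [|i IH]; rewrite ?addn0 ?drop0// addnS historyS. Qed.

End History.

Section IndexHistory.
Context {R : realType} {d : measure_display} {T : measurableType d}.
Variables (P : probability T R) (n : nat) (I : nat -> T -> 'I_n).
Hypotheses (n_gt0 : (0 < n)%N) (iidI : iid_uniform P I).

(** Puts the event in the form to which independence applies. The reversal restores chronological
    order; [Ordinal n_gt0] is only the default of [nth]. *)
Lemma history_bigcap k (s : k.-tuple 'I_n) :
  [set t | history I k t = s] =
  \bigcap_(i in [set` iota 0 k]) (I i @^-1` [set nth (Ordinal n_gt0) (rev s) i]).
Proof.
apply/seteqP; split => t /=.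
  by move=> <- i /=; rewrite mem_iota add0n => /= ik; rewrite /history revK nth_mkseq.
move=> h; rewrite /history -[RHS]revK; congr rev.
apply: (@eq_from_nth _ (Ordinal n_gt0)); first by rewrite size_mkseq size_rev size_tuple.
move=> i; rewrite size_mkseq => ik; rewrite nth_mkseq//.
by apply: h; rewrite /= mem_iota add0n.
Qed.

Lemma measurable_history k (s : k.-tuple 'I_n) :
  measurable [set t | history I k t = s].
Proof.
rewrite history_bigcap; apply: fin_bigcap_measurable; first exact: finite_seq.
by move=> i _; case: iidI.
Qed.

Lemma prob_history k (s : k.-tuple 'I_n) :
  P [set t | history I k t = s] = (n%:R^-1 ^+ k)%:E.
Proof.
have [_ PI indI] := iidI.
rewrite history_bigcap (indI _ (fun i => [set nth _ _ i])) ?iota_uniq//.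
under eq_bigr do rewrite PI.
rewrite prodEFin big_const_seq count_predT size_iota.
by rewrite -Monoid.iteropE.
Qed.

(** F of the history is a finite combination of indicators of the events [history I k t = s], each
    of probability n^(-k); nonnegativity lets the integral be split. *)
Lemma expectation_history k (F : seq 'I_n -> R) : (forall s, 0 <= F s) ->
  ('E_P[fun t => F (history I k t)] = (avg k F)%:E)%E.
Proof.
move=> F0; rewrite unlock.
transitivity (\int[P]_t (\sum_(s : k.-tuple 'I_n)
    ((F s)%:E * (\1_[set t | history I k t = s] t)%:E)))%E.
  apply: eq_integral => t _.
  have sk : size (history I k t) == k by rewrite size_history.
  rewrite (bigD1 (Tuple sk))//= big1 ?adde0.
    by rewrite indicE mem_set// mule1.
  move=> s sh; rewrite indicE memNset ?mule0//= => e.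
  by move/eqP: sh; apply; apply: val_inj.
rewrite ge0_integral_sum//; last 2 first.
- move=> s; apply: emeasurable_funM => //.
  by apply/measurable_realfun.measurable_EFinP;
     apply: measurable_realfun.measurable_indic; exact: measurable_history.
- by move=> s t _; rewrite mule_ge0// lee_fin// indicE.
rewrite avg_tuple mulr_sumr -sumEFin; apply: eq_bigr => s _.
rewrite ge0_integralZl//.
- rewrite integral_indic// ?setIT; first by rewrite [X in (_ * X)%E](prob_history s) -EFinM mulrC.
  exact: measurable_history.
- by apply/measurable_realfun.measurable_EFinP;
     apply: measurable_realfun.measurable_indic; exact: measurable_history.
- by rewrite lee_fin.
Qed.

End IndexHistory.

(** * Reduction to coordinates *)

Section DiagonalSums.
Context {R : realType} {n : nat}.

(** Describes a column of a rectangular diagonal matrix; j is a natural number since a column index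
    may exceed the number of rows, and the column is then zero. *)
Lemma sum_single_index (f : 'I_n -> R) (j : nat) :
  (forall i : 'I_n, (i : nat) != j -> f i = 0) ->
  (forall i, f i = 0) \/
  exists i0 : 'I_n, (i0 : nat) = j /\ forall i, i != i0 -> f i = 0.
Proof.
move=> f0; have [jn|nj] := ltnP j n.
  by right; exists (Ordinal jn); split=> // i ij; apply: f0.
by left=> i; apply: f0; rewrite neq_ltn (leq_trans _ nj).
Qed.

Lemma sqr_sum_single_index (f : 'I_n -> R) (j : nat) :
  (forall i : 'I_n, (i : nat) != j -> f i = 0) ->
  (\sum_i f i) ^+ 2 = \sum_i f i ^+ 2.
Proof.
move=> /sum_single_index[f0|[i0 [_ f0]]].
  by rewrite !big1 ?expr0n// => i _; rewrite f0 expr0n.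
rewrite (bigD1 i0)//= big1 ?addr0//.
by rewrite [RHS](bigD1 i0)//= big1 ?addr0// => i /f0 ->; rewrite expr0n.
Qed.

End DiagonalSums.

Section Norms.
Context {R : realType}.

Lemma l2norm_sqE m (u : 'cV[R]_m) : l2norm u ^+ 2 = \sum_i u i 0 ^+ 2.
Proof.
rewrite /l2norm sqr_sqrtr; first by apply: eq_bigr => i _; rewrite expr2.
by apply: sumr_ge0 => i _; rewrite -expr2 sqr_ge0.
Qed.

Lemma sum_sqE m (u : 'cV[R]_m) : \sum_i u i 0 ^+ 2 = (u^T *m u) 0 0.
Proof. by rewrite !mxE; apply: eq_bigr => i _; rewrite mxE expr2. Qed.

Lemma l2norm_sq_orthogonal m (V : 'M[R]_m) (u : 'cV[R]_m) : V^T *m V = 1%:M ->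
  l2norm u ^+ 2 = \sum_j (V^T *m u) j 0 ^+ 2.
Proof.
move=> /mulmx1C VV; rewrite l2norm_sqE !sum_sqE trmx_mul trmxK mulmxA.
by rewrite -[u^T *m V *m _]mulmxA VV mulmx1.
Qed.

(** The j-th column of V is a unit eigenvector for this eigenvalue. *)
Lemma eigenvalue_le_opnorm m (V : 'M[R]_m) (lam : 'rV[R]_m) (j : 'I_m) :
  V^T *m V = 1%:M -> (forall j, 0 <= lam 0 j) ->
  lam 0 j <= opnorm (V *m diag_mx lam *m V^T).
Proof.
move=> VV lam0; set B := _ *m _.
have VBu u l : (V^T *m (B *m u)) l 0 = lam 0 l * (V^T *m u) l 0.
  by rewrite /B !mulmxA VV mul1mx -mulmxA mul_diag_mx mxE.
have VD : V^T *m (V *m delta_mx j 0) = delta_mx j 0 :> 'cV_m.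
  by rewrite mulmxA VV mul1mx.
have nD (c : R) (u : 'cV_m) : 0 <= c ->
    (forall l, (V^T *m u) l 0 = c * (l == j)%:R) -> l2norm u = c.
  move=> c0 hu; apply/eqP; rewrite -(@eqrXn2 _ 2)// ?sqrtr_ge0//.
  rewrite (l2norm_sq_orthogonal _ VV) (bigD1 j)//= big1 ?addr0.
    by rewrite hu eqxx mulr1.
  by move=> l lj; rewrite hu (negbTE lj) mulr0 expr0n.
have n1 : l2norm (V *m delta_mx j 0 : 'cV_m) = 1.
  by apply: nD => // l; rewrite VD mxE eqxx andbT mul1r.
have nlam : l2norm (B *m (V *m delta_mx j 0 : 'cV_m)) = lam 0 j.
  apply: nD => // l; rewrite VBu VD !mxE eqxx andbT.
  by have [->//|] := eqVneq l j; rewrite !mulr0.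
apply: ub_le_sup; last by exists (V *m delta_mx j 0); rewrite //= n1.
(* The supremum dominates its set only if the set is bounded; the sum of the eigenvalues is a crude
   bound. *)
exists (\sum_l lam 0 l) => _ /= [u u1 <-].
have S0 : 0 <= \sum_l lam 0 l by apply: sumr_ge0.
rewrite -(@ler_pXn2r _ 2) ?nnegrE ?sqrtr_ge0//.
apply: (@le_trans _ _ ((\sum_l lam 0 l) ^+ 2 * l2norm u ^+ 2)).
  rewrite !(l2norm_sq_orthogonal _ VV) mulr_sumr; apply: ler_sum => l _.
  rewrite VBu exprMn ler_wpM2r ?sqr_ge0// lerXn2r ?nnegrE//.
  by rewrite (bigD1 l)//= lerDl sumr_ge0.
by rewrite ler_piMr ?sqr_ge0// exprn_ile1// sqrtr_ge0.
Qed.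

End Norms.

(** * Spectral data of A = Sigma V^T *)

Section DiagonalSVD.
Context {R : realType} {n m : nat}.
Variables (A Sigma : 'M[R]_(n, m)) (V : 'M[R]_m).
Hypotheses (n_gt0 : (0 < n)%N) (AE : A = Sigma *m V^T).
Hypotheses (Sdiag : is_diag_mx Sigma) (VV : V^T *m V = 1%:M).

(** The j-th eigenvalue of B. Summing over the column covers j >= n, where it is 0, without a case
    distinction. *)
Definition spec (j : 'I_m) : R := n%:R^-1 * \sum_i Sigma i j ^+ 2.

Definition noise_coef (xi : 'cV[R]_n) (j : 'I_m) : R :=
  n%:R^-1 * \sum_i Sigma i j * xi i 0.

Definition noise_sq (xi : 'cV[R]_n) (j : 'I_m) : R :=
  \sum_(i < n | (i : nat) == j) xi i 0 ^+ 2.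

Let S0 (i : 'I_n) (j : 'I_m) : (i : nat) != j -> Sigma i j = 0.
Proof. by move: i j; apply/is_diag_mxP. Qed.

Lemma spec_ge0 j : 0 <= spec j.
Proof. by rewrite mulr_ge0// sumr_ge0// => i _; rewrite sqr_ge0. Qed.

Lemma mean_sq_spec j :
  n%:R^-1 * (\sum_i (Sigma i j ^+ 2) ^+ 2) = n%:R * spec j ^+ 2.
Proof.
rewrite -(@sqr_sum_single_index _ _ _ j) => [|i /S0 ->]; last by rewrite expr0n.
by rewrite /spec; field; rewrite pnatr_eq0 -lt0n.
Qed.

(** Column j has at most one nonzero entry, so Cauchy-Schwarz is an equality with only the matching
    entry of xi; these entries sum to at most the squared norm of xi over all j. *)
Lemma noise_coef_sq xi j :
  n%:R * noise_coef xi j ^+ 2 = spec j * noise_sq xi j.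
Proof.
have nn0 : n%:R != 0 :> R by rewrite pnatr_eq0 -lt0n.
have E : (\sum_i Sigma i j * xi i 0) ^+ 2 =
    (\sum_i Sigma i j ^+ 2) * noise_sq xi j.
  rewrite (@sqr_sum_single_index _ _ _ j) => [|i /S0 ->]; last by rewrite mul0r.
  rewrite mulr_suml; apply: eq_bigr => i _; rewrite exprMn.
  have [ij|/S0 ->] := eqVneq (i : nat) j; last by rewrite expr0n !mul0r.
  congr (_ * _); rewrite /noise_sq (bigD1 i) ?ij//= big1 ?addr0//.
  by move=> i' /andP[/eqP i'j]; rewrite -val_eqE/= i'j ij eqxx.
by rewrite /noise_coef exprMn E /spec; field.
Qed.

Lemma sum_noise_sq_le xi : \sum_j noise_sq xi j <= l2norm xi ^+ 2.
Proof.
rewrite l2norm_sqE /noise_sq (exchange_big_dep xpredT)//=; apply: ler_sum => i _.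
have [im|mi] := ltnP i m.
  rewrite (bigD1 (Ordinal im))//= big1 ?addr0// => j /andP[/eqP ij].
  by rewrite -val_eqE /= ij eqxx.
rewrite big1 ?sqr_ge0// => j /eqP ij.
by move: mi; rewrite ij leqNgt ltn_ord.
Qed.

Lemma gram_SigmaE : n%:R^-1 *: (Sigma^T *m Sigma) = diag_mx (\row_j spec j).
Proof.
apply/matrixP => j l; rewrite !mxE; have [->|jl] := eqVneq j l.
  by rewrite mulr1n /spec; congr (_ * _); apply: eq_bigr => i _; rewrite mxE expr2.
rewrite mulr0n big1 ?mulr0// => i _; rewrite mxE.
have [ij|/S0 ->] := eqVneq (i : nat) j; last by rewrite mul0r.
by rewrite (@S0 i l) ?mulr0// ij; apply: contra_neq jl => /val_inj.
Qed.

Lemma normal_mxE : normal_mx A = V *m diag_mx (\row_j spec j) *m V^T.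
Proof.
rewrite /normal_mx AE trmx_mul trmxK -gram_SigmaE -scalemxAr -scalemxAl.
by rewrite !mulmxA.
Qed.

Lemma spec_le_opnorm j : spec j <= opnorm (normal_mx A).
Proof.
rewrite normal_mxE; have := @eigenvalue_le_opnorm _ _ V (\row_j spec j) j VV.
by rewrite mxE; apply => l; rewrite mxE spec_ge0.
Qed.

Lemma psd_powR_normal_mx nu (w : 'cV[R]_m) j :
  (V^T *m (psd_powR (normal_mx A) nu *m w)) j 0 =
  spec j `^ nu * (V^T *m w) j 0.
Proof.
have -> : psd_powR (normal_mx A) nu =
    V *m diag_mx (map_mx (fun x => x `^ nu) (\row_j spec j)) *m V^T.
  apply: psd_powRE; exists V, (\row_j spec j); split=> //.
  - by move=> i; rewrite mxE spec_ge0.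
  - exact: normal_mxE.
by rewrite !mulmxA VV mul1mx -mulmxA mul_diag_mx !mxE.
Qed.

Lemma step_spec_le (c0 X : R) j : 0 < c0 ->
  (c0%:E <= (Num.max (\big[Num.max/0]_(i < n) l2norm (rowv A i) ^+ 2) X)%:E^-1)%E ->
  n%:R * (c0 * spec j) <= 1.
Proof.
move=> c00; set Y := Num.max _ _ => hc.
have -> : n%:R * (c0 * spec j) = c0 * \sum_i Sigma i j ^+ 2.
  by rewrite /spec; field; rewrite pnatr_eq0 -lt0n.
have Sj0 (i : 'I_n) : (i : nat) != j -> Sigma i j ^+ 2 = 0.
  by move=> /S0 ->; rewrite expr0n.
have [f0|[i0 [_ f0]]] := sum_single_index Sj0; first by rewrite big1 ?mulr0.
rewrite (bigD1 i0)//= big1// addr0.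
have SY : Sigma i0 j ^+ 2 <= Y.
  rewrite le_max (le_trans _ (le_bigmax _ _ i0))//.
  rewrite (l2norm_sq_orthogonal _ VV) (bigD1 j)//=.
  have -> : V^T *m rowv A i0 = (row i0 Sigma)^T.
    by rewrite /rowv AE row_mul trmx_mul trmxK mulmxA VV mul1mx.
  by rewrite !mxE lerDl sumr_ge0// => l _; rewrite sqr_ge0.
(* A nonzero entry makes Y > 0, and only then is the inverse in [\bar R] a real inverse. *)
have [S00|S00] := eqVneq (Sigma i0 j ^+ 2) 0; first by rewrite S00 mulr0.
have Y0 : 0 < Y by apply: lt_le_trans SY; rewrite lt_neqAle eq_sym S00 sqr_ge0.
move: hc; rewrite inver gt_eqF// lee_fin => hc.
have := ler_pM (ltW c00) (sqr_ge0 _) hc SY.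
by rewrite mulVf// gt_eqF.
Qed.

(** * The SVRG recursion in the basis V *)

Section Iterates.
Variables (y0 xi : 'cV[R]_n) (xdag x0 : 'cV[R]_m) (c0 : R) (M : nat) (T : Type).
Variables (I : nat -> T -> 'I_n) (x : nat -> T -> 'cV[R]_m).
Hypotheses (M_gt0 : (0 < M)%N) (Axdag : A *m xdag = y0).
Hypothesis (svrgx : is_svrg A (y0 + xi) c0 M x0 I x).

(** The row a_i is a multiple of the i-th column of V, or zero, so the rank-one map a_i a_i^T is
    diagonal in this basis. *)
Lemma rowv_coord i u j :
  (V^T *m (dotp (rowv A i) u *: rowv A i)) j 0 =
  Sigma i j ^+ 2 * (V^T *m u) j 0.
Proof.
have VT : V^T *m rowv A i = (row i Sigma)^T.
  by rewrite /rowv AE row_mul trmx_mul trmxK mulmxA VV mul1mx.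
have -> : dotp (rowv A i) u = \sum_l Sigma i l * (V^T *m u) l 0.
  have -> : dotp (rowv A i) u = ((rowv A i)^T *m u) 0 0.
    by rewrite mxE; apply: eq_bigr => l _; rewrite [in RHS]mxE.
  rewrite /rowv trmxK AE row_mul -mulmxA mxE.
  by apply: eq_bigr => l _; rewrite [row _ _ _ _]mxE.
rewrite -scalemxAr VT [LHS]mxE [X in _ * X]mxE [X in _ * X]mxE.
have [Sij|Sij] := eqVneq (Sigma i j) 0; first by rewrite Sij mulr0 expr0n mul0r.
have ij : (i : nat) = j by apply/eqP; apply: contra_neqT Sij => /S0.
rewrite (bigD1 j)//= big1 ?addr0; first by ring.
by move=> l lj; rewrite (@S0 i l) ?mul0r// ij; apply: contra_neq lj => /val_inj.
Qed.

Lemma lsq_grad_coord u j :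
  (V^T *m lsq_grad A (y0 + xi) u) j 0 =
  spec j * (V^T *m (u - xdag)) j 0 - noise_coef xi j.
Proof.
have -> : lsq_grad A (y0 + xi) u =
    normal_mx A *m (u - xdag) - n%:R^-1 *: (A^T *m xi).
  rewrite /lsq_grad /normal_mx -Axdag opprD addrA -mulmxBr [A^T *m _]mulmxBr scalerBr.
  by rewrite -scalemxAl mulmxA.
rewrite normal_mxE AE trmx_mul trmxK mulmxBr -scalemxAr !mulmxA VV !mul1mx.
rewrite mxE [X in _ + X]mxE [X in _ - X]mxE [X in _ - _ * X]mxE; congr (_ - _).
  by rewrite -mulmxA mul_diag_mx !mxE.
by congr (_ * _); apply: eq_bigr => i _; rewrite mxE.
Qed.

Let err k t j := (V^T *m (x k t - xdag)) j 0.
Let b j i := Sigma i j ^+ 2.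

Lemma svrg_coordS k t j : let e := err (k %/ M * M)%N t j in
  err k.+1 t j = err k t j - c0 * (b j (I k t) * (err k t j - e)
    + (spec j * e - noise_coef xi j)).
Proof.
move=> e; rewrite /err /e; have [_ ->] := svrgx.
set xM := x (k %/ M * M)%N t.
rewrite addrAC mulmxBr mxE; congr (_ + _).
rewrite -scalemxAr [LHS]mxE [X in - X]mxE; congr (- (_ * _)).
rewrite mulmxDr mxE lsq_grad_coord; congr (_ + _).
rewrite rowv_coord /b; congr (_ * _).
have -> : x k t - xM = (x k t - xdag) - (xM - xdag) by rewrite opprB addrA subrK.
rewrite mulmxBr.
by rewrite [LHS]mxE [X in _ + X]mxE.
Qed.

(** Induction on i: a step from K M + i has i < M, so its anchor is still K M. The case i = M yields
    the next anchor. *)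
Lemma epoch_coord K t j i : (i <= M)%N ->
  let e := err (K * M) t j in
  err (K * M + i) t j =
  e - (spec j * e - noise_coef xi j) *
      epoch_weight (b j) c0 (take i (history I (K * M + i) t)).
Proof.
move=> iM e; elim: i iM => [|i IH] iM.
  by rewrite addn0 take0 mulr0 subr0.
rewrite addnS svrg_coordS (divnMDl K i M_gt0) (divn_small iM) addn0 -/e.
by rewrite (IH (ltnW iM)) historyS /=; ring.
Qed.

Lemma err_epochE K t j : err (K * M) t j =
  epoch_error (b j) c0 (spec j) M (noise_coef xi j) ((V^T *m (x0 - xdag)) j 0) K
    (history I (K * M) t).
Proof.
elim: K => [|K IH]; first by rewrite /err mul0n; have [->] := svrgx.
rewrite mulSnr (@epoch_coord K t j M (leqnn M)) /= drop_history -IH.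
by [].
Qed.

Lemma sq_dist_epochE K t : l2norm (x (K * M) t - xdag) ^+ 2 =
  \sum_j epoch_error (b j) c0 (spec j) M (noise_coef xi j)
    ((V^T *m (x0 - xdag)) j 0) K (history I (K * M) t) ^+ 2.
Proof.
rewrite (l2norm_sq_orthogonal _ VV); apply: eq_bigr => j _.
by rewrite -err_epochE.
Qed.

End Iterates.
End DiagonalSVD.

(** * Summation over the coordinates *)

Theorem theorem2p1 (R : realType) (n m M : nat)
    (hn : (0 < n)%N) (hm : (0 < m)%N) (hM : (0 < M)%N)
    (A : 'M[R]_(n, m)) (x0 xdag : 'cV[R]_m) (ydag xi : 'cV[R]_n)
    (hydag : exists z : 'cV[R]_m, A *m z = ydag)
    (hxdag : is_closest_solution A ydag x0 xdag)
    (c0 nu cstar : R) (w : 'cV[R]_m)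
    (Sigma : 'M[R]_(n, m)) (V : 'M[R]_m)
    (d : measure_display) (T : measurableType d) (P : probability T R)
    (I : nat -> T -> 'I_n) (x : nat -> T -> 'cV[R]_m) :
  let ydelta : 'cV[R]_n := ydag + xi in
  let delta : R := l2norm xi in
  let bdelta : R := (Num.sqrt n%:R)^-1 * delta in
  let B : 'M[R]_m := normal_mx A in
  let nB : R := opnorm B in
  let cB : R := (1 - c0 * nB) ^- M in
  let cBM : R := \sum_(1 <= i < M) (1 - (1 - c0 * nB) ^+ i) ^+ 2 in
  let cnu : R := nu `^ nu * (M%:R * c0) `^ (- nu) in
  let cstar2 : R := (3 + 2 * (M%:R * c0 * nB) ^+ 2)
                * n%:R * M%:R * cB * c0 ^+ 2 * nB in
  nB <= 1 ->
  c0 * nB < 1 ->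
  0 < c0 ->
  (* the inverse is taken in \bar R, so that it is +oo when A = 0 *)
  (c0%:E <= (Num.max (\big[Num.max/0]_(i < n) l2norm (rowv A i) ^+ 2)
                     (nB ^+ 2))%:E^-1)%E ->
  0 < nu ->
  xdag - x0 = psd_powR B nu *m w ->
  A = Sigma *m V^T ->
  is_diag_mx Sigma ->
  (forall i j, 0 <= Sigma i j) ->
  V^T *m V = 1%:M ->
  1 < cstar ->
  (4 + 2 * (M%:R * c0 * nB) ^+ 2) * n%:R * M%:R ^- 2 * cB * cBM
    <= 1 - cstar^-1 ->
  iid_uniform P I ->
  is_svrg A ydelta c0 M x0 I x ->
  forall K : nat, (0 < K)%N ->
  ('E_P[fun t => (l2norm (x (K * M)%N t - xdag) ^+ 2)%R] <=
   ((2 + 2 `^ (2 * nu) * nB * cstar2 * cstar)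
      * cnu ^+ 2 * K%:R `^ (- (2 * nu)) * l2norm w ^+ 2
    + (2 * M%:R * c0 + cstar2 * cstar) * K%:R * bdelta ^+ 2)%:E)%E.
Proof.
move=> ydelta delta bdelta B nB cB cBM cnu cstar2 _ cL c00 hc nu0 src AE Sd _ VV
  cs1 hstar iidI svrgx K K0.
have [Axdag _] := hxdag.
set F := fun (j : 'I_m) s => epoch_error (fun i => Sigma i j ^+ 2) c0
  (spec Sigma j) M (noise_coef Sigma xi j) ((V^T *m (x0 - xdag)) j 0) K s ^+ 2.
have -> : (fun t => l2norm (x (K * M)%N t - xdag) ^+ 2) =
    (fun t => \sum_j F j (history I (K * M) t)).
  by apply/funext => t; rewrite (sq_dist_epochE AE Sd VV hM Axdag svrgx).
rewrite (@expectation_history _ _ _ _ _ _ hn iidI _ (fun s => \sum_j F j s)); last first.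
  by move=> s; apply: sumr_ge0 => j _; rewrite sqr_ge0.
rewrite lee_fin avg_sum.
set C1 := 2 + _; set C2 := 2 * M%:R * c0 + _.
have Fle j : avg (K * M) (F j) <= C1 * cnu ^+ 2 * K%:R `^ (- (2 * nu)) * (V^T *m w) j 0 ^+ 2 +
    C2 * K%:R * (n%:R^-1 * noise_sq xi j).
  apply: (avg_sq_epoch_error_le hn _ _ c00 _ _ cL hM K0 nu0 cs1 hstar).
  - by [].
  - exact: mean_sq_spec.
  - by rewrite spec_ge0 (spec_le_opnorm AE Sd VV).
  - exact: (step_spec_le hn AE Sd VV j c00 hc).
  (* The errors start at x0 - xdag, the opposite of the source element; the sign disappears in the
     square. *)
  - have -> : x0 - xdag = - (psd_powR B nu *m w) by rewrite -src opprB.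
    rewrite mulmxN mxE sqrrN (psd_powR_normal_mx AE Sd VV) exprMn.
    by rewrite -powR_double// spec_ge0.
  - by rewrite (noise_coef_sq hn Sd).
  - by apply: sumr_ge0 => i _; rewrite sqr_ge0.
apply: (le_trans (ler_sum _ (fun j _ => Fle j))).
rewrite big_split/= -!mulr_sumr -(l2norm_sq_orthogonal _ VV) lerD2l.
rewrite /bdelta exprMn exprVn sqr_sqrtr//.
(* The noise entries sum to at most the squared norm of xi, so it remains to see that their
   coefficient [C2] is nonnegative. *)
have cB0 : 0 <= cB by rewrite invr_ge0 exprn_ge0// subr_ge0 ltW.
have nB0 : 0 <= nB.
  by apply: le_trans (spec_le_opnorm AE Sd VV (Ordinal hm)); exact: spec_ge0.
have c0_ge0 := ltW c00.
have cs2 : 0 <= cstar2.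
  have Z0 : 0 <= 3 + 2 * (M%:R * c0 * nB) ^+ 2.
    by rewrite addr_ge0// mulr_ge0// sqr_ge0.
  by rewrite /cstar2 !mulr_ge0// ?sqr_ge0.
have cs0 : 0 <= cstar by apply: ltW; apply: lt_trans cs1.
have C20 : 0 <= C2 by apply: addr_ge0 _ (mulr_ge0 cs2 cs0); rewrite !mulr_ge0.
rewrite ler_wpM2l ?mulr_ge0// ler_wpM2l ?invr_ge0//.
exact: sum_noise_sq_le.
Qed.
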